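(* Assume the Continuum Hypothesis. Then there is a crowded, zero-dimensional Hausdorff topological space $X$ with $|X|=w(X)=\omega_1$ such that every countably infinite discrete subset of $X$ is closed in $X$, and $X$ is $Nwd_\omega(X)$-selectively pseudocompact, where $Nwd_\omega(X)$ is the family of countably infinite nowhere dense subsets of $X$.
   Context: For a topological space $X$ and $\mathcal A\subseteq\mathcal P(X)$, $X$ is called $\mathcal A$-selectively pseudocompact if for every sequence $\langle U_n:n\in\omega\rangle$ of pairwise disjoint non-empty open subsets of $X$ one can choose sets $A_n\in\mathcal A$ with $A_n\subseteq U_n$ such that the family $\{A_n:n\in\omega\}$ has an accumulation point, i.e. there is a point $x\in X$ every neighbourhood of which meets $A_n$ for infinitely many $n$. A space is crowded if it has no isolated points; $w(X)$ is the weight of $X$. *)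

(* Defs.v *)
From HB Require Import structures.
From mathcomp Require Import all_boot all_order.
From mathcomp Require Import all_classical all_reals all_analysis.
Set Implicit Arguments. Unset Strict Implicit. Unset Printing Implicit Defensive.
Local Open Scope classical_set_scope.

(* A has cardinality aleph_1: A is uncountable and carries a strict
   well-order all of whose proper initial segments are countable
   (i.e. A has order type omega_1 under some ordering). *)
Definition is_aleph1 {T : Type} (A : set T) : Prop :=
  ~ countable A /\
  exists lt : T -> T -> Prop,
    [/\ (forall x, A x -> ~ lt x x),
        (forall x y z, A x -> A y -> A z -> lt x y -> lt y z -> lt x z),
        (forall x y, A x -> A y -> [\/ lt x y, x = y | lt y x]),
        (forall S : set T, S `<=` A -> S !=set0 ->
           exists2 m, S m & forall y, S y -> ~ lt y m) &
        (forall x, A x -> countable [set y | A y /\ lt y x])].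

Definition CH : Prop := is_aleph1 [set: nat -> bool].

Section Top.
Context {X : topologicalType}.

Definition crowded : Prop := forall x : X, ~ isolated [set: X] x.

Definition zero_dim : Prop := exists2 B : set (set X), B `<=` clopen & basis B.

(* w(X) = aleph_1: no countable base, but a base of cardinality aleph_1
   (hence the minimal cardinality of a base is aleph_1) *)
Definition weight_aleph1 : Prop :=
  ~ @second_countable X /\ exists2 B : set (set X), basis B & is_aleph1 B.

Definition discrete_subset (D : set X) : Prop := forall x, D x -> isolated D x.

Definition countably_infinite {T : Type} (A : set T) : Prop :=
  countable A /\ infinite_set A.

Definition nowhere_dense (A : set X) : Prop := interior (closure A) = set0.

Definition Nwd_omega : set (set X) :=
  [set A | countably_infinite A /\ nowhere_dense A].

Definition accumulation_point_family (A : nat -> set X) (x : X) : Prop :=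
  forall V, nbhs x V -> infinite_set [set n | V `&` A n !=set0].

Definition selectively_pseudocompact (F : set (set X)) : Prop :=
  forall U : nat -> set X,
    (forall n, open (U n)) -> (forall n, U n !=set0) ->
    (forall n m, n <> m -> U n `&` U m = set0) ->
    exists A : nat -> set X,
      (forall n, F (A n) /\ A n `<=` U n) /\
      exists x, accumulation_point_family A x.
End Top.
Arguments crowded : clear implicits.
Arguments zero_dim : clear implicits.
Arguments weight_aleph1 : clear implicits.

(* Main.v *)
(* Points are C + W, where W = 2^omega carries an order of type omega_1 (by CH)
   and C consists of countably many fibres N_z = {(z, k) : k in omega}, z a finite
   set of naturals. The topology is given by a 0/1 matrix F with rows the points
   and columns omega + W, each column becoming a clopen set. Column m in omega
   is the m-th bit of z on N_z. The columns in W are kept independent on every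
   N_z, so each N_z is crowded, while the bits make it nowhere dense; the union of
   the N_z is dense.
   F is built by recursion on a in W. Stage a handles a sequence (u_n) of earlier
   points, every sequence being treated cofinally often:
   - column a, if D = {u_1, u_2, ...} is discrete so far and misses u_0, is 1 on D
     and 0 at u_0, which keeps u_0 out of the closure of D. Elsewhere it splits
     the countably many infinite sets "fibre meets earlier basic box"; these sets
     stay infinite off the discrete set D, so independence survives;
   - row a is an ultrafilter limit of the rows of the u_n.
   If y_n = (z_n, k_n) lies in a basic box B_n, the limit point of (y_n) is an
   accumulation point of the nowhere dense sets A_n = B_n meet N_{z_n}: the later
   columns cannot destroy this because they are independent on N_{z_n}. *)
Require Import Defs.
From HB Require Import structures.
From mathcomp Require Import all_boot all_order.
From mathcomp Require Import all_classical all_reals all_analysis.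
Set Implicit Arguments. Unset Strict Implicit. Unset Printing Implicit Defensive.
Local Open Scope classical_set_scope.

(** * Splitting countably many infinite sets of naturals at once *)

Definition unbounded (A : set nat) : Prop := forall N, exists2 k, (N <= k)%N & A k.

Lemma unboundedS (A B : set nat) : A `<=` B -> unbounded A -> unbounded B.
Proof. by move=> AB uA N; have [k Nk /AB] := uA N; exists k. Qed.

Lemma unbounded_infinite (A : set nat) : unbounded A -> infinite_set A.
Proof.
move=> uA /finite_setP[n]; rewrite card_eq_sym => /card_set_bijP[f fb].
have [k] := uA (\max_(i < n) f i).+1; rewrite ltnNge => /negP kN Ak; apply: kN.
have [_ _ /(_ k Ak)[i /= lin <-]] := fb.
exact: (@leq_bigmax _ (fun i : 'I_n => f i) (Ordinal lin)).
Qed.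

(** A requirement (i, b, N) asks for a point of [S i] past [N] with colour [b]. Serving all
    requirements along a strictly increasing [p] gives no point two colours. *)
Lemma split_unbounded (I : countType) (S : I -> set nat) :
  exists g : nat -> bool, forall i b, unbounded (S i) ->
    unbounded (S i `&` [set k | g k = b]).
Proof.
pose J := (I * bool * nat)%type.
(* [lo] will keep [p] increasing; it is also the answer when the code has no meaning or [S i] is
   bounded. *)
have /choice[pk pkP] : forall x : nat * nat, exists k, (x.2 <= k)%N /\
    forall i b N, unpickle x.1 = Some ((i, b, N) : J) -> unbounded (S i) ->
      (N <= k)%N /\ S i k.
  move=> [m lo] /=; case: (unpickle m : option J) => [[[i b] N]|]; last by exists lo.
  have [uS|nuS] := pselect (unbounded (S i)).
    have [k kl Sk] := uS (maxn N lo); move: kl; rewrite geq_max => /andP[Nk lok].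
    by exists k; split=> // i' b' N' [<- _ <-].
  by exists lo; split=> // i' b' N' [<- _ _] /nuS.
pose fix p m := pk (m, if m is m'.+1 then (p m').+1 else 0%N).
have p_lt : {homo p : i j / (i < j)%N}.
  by apply: homo_ltn => [? ? ?|m]; [exact: ltn_trans|have [] := pkP (m.+1, (p m).+1)].
have p_inj : injective p.
  by move=> i j pij; case: (ltngtP i j) => // /p_lt; rewrite pij ltnn.
exists (fun k => `[< exists m i N, unpickle m = Some ((i, true, N) : J) /\ p m = k >]).
move=> i b uS N; pose m := pickle ((i, b, N) : J).
have pm : (N <= p m)%N /\ S i (p m).
  have E : exists lo, p m = pk (m, lo).
    by case: (m) => [|n]; [exists 0%N|exists (p n).+1].
  case: E => lo ->; have [_ H] := pkP (m, lo).
  by apply: (H i b N) => //=; rewrite pickleK.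
exists (p m); first exact: pm.1; split; first exact: pm.2.
rewrite /=; case: (b) @m pm => m _.
  by apply/asboolP; exists m, i, N; rewrite pickleK.
apply/asboolP => -[m' [i' [N' [em' /p_inj emm]]]].
by move: em'; rewrite emm pickleK.
Qed.

(** [P] takes a total function, of which only the values below [a] are known at stage [a]; [d0]
    fills in the others. *)
Lemma wf_choice (W D : Type) (lt : W -> W -> Prop) (d0 : D)
    (P : W -> (W -> D) -> D -> Prop) :
  well_founded lt -> (forall a f, exists d, P a f d) ->
  exists S : W -> D, forall a, exists2 f, (forall b, lt b a -> f b = S b) & P a f (S a).
Proof.
move=> wf Pex.
have /choice[C CP] : forall x : W * (W -> D), exists d, P x.1 x.2 d.
  by move=> [a f]; exact: Pex.
pose ext a (rec : forall b, lt b a -> D) b :=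
  if pselect (lt b a) is left h then rec b h else d0.
exists (Fix wf (fun=> D) (fun a rec => C (a, ext a rec))) => a.
rewrite Fix_eq; last first.
  move=> x f g fg; congr (C (_, _)); apply/funext => b; rewrite /ext.
  by case: pselect.
eexists; last exact: (CP (a, _)).
by move=> b ba /=; rewrite /ext; case: pselect.
Qed.

Lemma countable_inr (A B : Type) (C : set (A + B)) (D : set B) :
  countable C -> (forall b, D b -> C (inr b)) -> countable D.
Proof.
move=> /countable_injP[f fi] DC; apply/countable_injP; exists (f \o inr) => b b'.
rewrite !inE => /DC Cb /DC Cb' E.
by have [] : inr b = inr b' :> A + B by apply: fi; rewrite ?inE.
Qed.

Lemma countableU (T : Type) (A B : set T) : countable A -> countable B -> countable (A `|` B).
Proof.
by move=> cA cB; rewrite -bigcup2E; apply: bigcup_countable => // -[|[|i]] _ //=.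
Qed.

(** * Matrices and the properties required of them *)

Definition agree (P : Type) (K : eqType) (F : P -> K -> bool) (s : seq K) x y :=
  forall j, j \in s -> F x j = F y j.

Notation points W := (seq nat * nat + W)%type.
Notation columns W := (nat + W)%type.

Definition fiber_box {W : choiceType} (F : points W -> columns W -> bool)
    (s : seq W) (phi : W -> bool) (z : seq nat) : set nat :=
  [set k | forall g, g \in s -> F (inl (z, k)) (inr g) = phi g].

Section MatrixProperties.
Context {W : choiceType} (F : points W -> columns W -> bool).

Definition bit_columns := forall z k m, F (inl (z, k)) (inl m) = (m \in z).

Definition fiber_independent := forall s phi z, unbounded (fiber_box F s phi z).

(** [u] may repeat points, so isolation concludes [u n' = u n] rather than [n' = n]. *)
Definition separates_discrete := forall (u : nat -> points W) x,
  (forall n, exists s, forall n', agree F s (u n) (u n') -> u n' = u n) ->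
  (forall n, u n <> x) ->
  exists g, F x (inr g) = false /\ forall n, F (u n) (inr g) = true.

(* [t n] stands for the basic box around [y n] given by the columns in [t n]. *)
Definition has_fiber_limits :=
  forall (y : nat -> seq nat * nat) (t : nat -> seq (columns W)),
  exists x, forall s, unbounded [set n | exists k,
    agree F s (inl ((y n).1, k)) x /\ agree F (t n) (inl ((y n).1, k)) (inl (y n))].

End MatrixProperties.

Definition rights (A B : eqType) (s : seq (A + B)) :=
  [seq b | x <- s, b <- if x is inr b then [:: b] else [::]].

Lemma mem_rights (A B : eqType) (s : seq (A + B)) b : (b \in rights s) = (inr b \in s).
Proof.
apply/allpairsPdep/idP => [[[a|c] [c' [cs //]]]|bs].
  by rewrite inE => /eqP-> ->.
by exists (inr b), b; rewrite inE.
Qed.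

(** * Recursive construction of the matrix *)

Section Matrix.
Context {W : choiceType} (lt : W -> W -> Prop).
Implicit Types (G : points W -> columns W -> bool) (s : seq W) (z : seq nat).

Definition below {A : Type} a (x : A + W) := if x is inr b then lt b a else True.

(** Stage [b] supplies column [b] and row [b]. Where a row in [W] crosses a column in [W], the later
    stage decides, and the row does on the diagonal; entries with both indices below [a] thus depend
    only on stages below [a]. *)
Definition entries (S : W -> (points W -> bool) * (columns W -> bool)) :
    points W -> columns W -> bool :=
  fun p j => match p, j with
  | inl y, inl m => m \in y.1
  | inl y, inr g => (S g).1 p
  | inr b, inl m => (S b).2 j
  | inr b, inr g => if `[< lt b g >] then (S g).1 p else (S b).2 j
  end.

Definition segment a s := forall g, g \in s -> lt g a.

Definition independent_below a G := forall s phi z,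
  segment a s -> unbounded (fiber_box G s phi z).

Definition discrete_below a G (D : set (points W)) :=
  (forall d, D d -> below a d) /\
  forall d, D d -> exists2 s : seq (columns W), (forall j, j \in s -> below a j) &
    forall d', D d' -> agree G s d d' -> d' = d.

Variable task : W -> nat -> points W.

Definition task_set a := [set task a n.+1 | n in [set: nat]].

(** Splitting is demanded box by box, without presupposing independence, so every stage is solvable
    for arbitrary earlier data and the recursion carries no invariant. *)
Definition good_column a G (c : points W -> bool) :=
  (forall s phi z b, segment a s -> unbounded (fiber_box G s phi z) ->
     unbounded (fiber_box G s phi z `&` [set k | c (inl (z, k)) = b])) /\
  (independent_below a G -> discrete_below a G (task_set a) ->
   ~ task_set a (task a 0) ->
   c (task a 0) = false /\ forall d, task_set a d -> c d = true).

Definition good_row a G (r : columns W -> bool) :=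
  (forall n, below a (task a n)) -> forall s : seq (columns W), (forall j, j \in s -> below a j) ->
  unbounded [set n | forall j, j \in s -> G (task a n) j = r j].

(** The limit is along an ultrafilter containing all tails: finitely many columns take their limit
    values on a member of it, which meets every tail. *)
Lemma good_rowP a G : exists r, good_row a G r.
Proof.
have [U [UU sU]] := ultraFilterLemma (eventually_filter).
have FU : ProperFilter U by exact: ultra_proper.
have fU : Filter U by exact: filter_filter.
pose r j := `[< U [set n | G (task a n) j = true] >].
exists r => _ s _ N.
have Ur j : U [set n | G (task a n) j = r j].
  have [Uj|Uj] := in_ultra_setVsetC [set n | G (task a n) j = true] UU.
    by rewrite /r asboolT.
  rewrite /r asboolF.
    by move: Uj; apply: filterS => n /= /negP /negbTE.
  by move=> Uj'; have [n []] := filter_ex (filterI Uj Uj').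
have Us : U [set n | forall j, j \in s -> G (task a n) j = r j].
  elim: s => [|i s IHs]; first exact: filterE.
  apply: filterS (filterI (Ur i) IHs : U _) => n /= [Hi Hs] j; rewrite inE => /orP[/eqP->//|]; exact: Hs.
have UN : U [set n | (N <= n)%N] by apply: sU; exists N.
have [k [Nk sk]] := filter_ex (filterI UN Us).
by exists k.
Qed.

Hypothesis countable_below : forall a, countable [set b | lt b a].

Lemma split_column a G (D : set (points W)) x : ~ D x ->
  (forall s phi z, segment a s -> unbounded (fiber_box G s phi z) ->
     unbounded (fiber_box G s phi z `\` [set k | D (inl (z, k))])) ->
  exists c, [/\ forall s phi z b, segment a s -> unbounded (fiber_box G s phi z) ->
       unbounded (fiber_box G s phi z `&` [set k | c (inl (z, k)) = b]),
     c x = false & forall d, D d -> c d = true].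
Proof.
move=> Dx thin.
have /countable_injP[f finj] := countable_below a.
(* [f] codes the predecessors of [a], so the boxes are indexed by a countable type: finite lists of
   coded columns with prescribed values. *)
pose S z (t : seq (nat * bool)) : set nat := [set k | ~ D (inl (z, k)) /\ inl (z, k) <> x /\
  forall g, lt g a -> forall b, (f g, b) \in t -> G (inl (z, k)) (inr g) = b].
have /choice[g gP] := fun z => split_unbounded (S z).
exists (fun p => `[< D p >] || (p != x) && (if p is inl y then g y.1 y.2 else false)).
split=> [s phi z b sa us||d Dd]; last 2 first.
- by rewrite asboolF // eqxx.
- by rewrite asboolT.
pose t := [seq (f h, phi h) | h <- s].
have St : S z t `<=` fiber_box G s phi z.
  by move=> k [_ [_ Sk]] h hs; apply: Sk (sa _ hs) _ _; apply/mapP; exists h.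
have uS : unbounded (S z t).
  move=> N.
  have [k0 k0P] : exists k0, forall k, (k0 <= k)%N -> inl (z, k) <> x.
    case: (x) => [[z' k']|w]; last by exists 0%N.
    by exists k'.+1 => k kk [_ E]; rewrite E ltnn in kk.
  have [k kk [sk Dk]] := thin _ _ _ sa us (maxn N k0).
  move: kk; rewrite geq_max => /andP[Nk kk].
  exists k => //; split=> //; split; first exact: k0P.
  move=> h ha b' /mapP[h' h's [fh ->]].
  have -> : h = h' by apply: finj; rewrite ?inE //=; exact: sa.
  exact: sk.
apply: unboundedS (gP z t b uS) => k [Sk gk]; split; first exact: St.
case: Sk => [Dk [kx _]] /=; rewrite asboolF //=.
by have /eqP -> := kx.
Qed.

Lemma good_columnP a S : exists c, good_column a (entries S) c.
Proof.
set G := entries S.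
have [[ind [disc Dx]]|nP] := pselect (independent_below a G /\
  discrete_below a G (task_set a) /\ ~ task_set a (task a 0)); last first.
  have [||c [c1 _ _]] := @split_column a G set0 (task a 0).
  - by [].
  - by move=> s phi z _; apply: unboundedS => k kP; split.
  by exists c; split=> // i d t; case: nP.
have [|c [c1 c2 c3]] := @split_column a G (task_set a) (task a 0) Dx; last by exists c; split.
(* If [k0] lies in the task set, the columns isolating it are added to the box with their values at
   [k0]. Independence gives a point past [k0] there, and isolation keeps that point out of the task
   set. *)
move=> s phi z sa us N; have [k0 Nk0 k0s] := us N.
have [Dk0|] := pselect (task_set a (inl (z, k0))); last by exists k0.
have [_ /(_ _ Dk0)[t ta tP]] := disc.
have [|k k0k ks] := ind (s ++ rights t) (fun g => G (inl (z, k0)) (inr g)) z _ k0.+1.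
  by move=> g; rewrite mem_cat => /orP[/sa//|]; rewrite mem_rights => /ta.
exists k; first by rewrite (leq_trans Nk0) // ltnW.
split=> [g gs|/= Dk]; first by rewrite ks ?mem_cat ?gs //; exact: k0s.
suff /(tP _ Dk)[E] : agree G t (inl (z, k0)) (inl (z, k)) by rewrite E ltnn in k0k.
by move=> [m|g] jt //; apply/esym/ks; rewrite mem_cat mem_rights jt orbT.
Qed.

Section Transfer.
Context a G G' (GG' : forall p j, below a p -> below a j -> G p j = G' p j).

Lemma fiber_box_eq s phi z : segment a s -> fiber_box G s phi z = fiber_box G' s phi z.
Proof.
by move=> sa; apply/seteqP; split=> k ks g gs; rewrite -ks // GG' //; exact: sa.
Qed.

(** A stage reads only entries below [a]; this carries its guarantees from the provisional function
    of the recursion to the final matrix. *)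
Lemma good_column_eq c : good_column a G c -> good_column a G' c.
Proof.
case=> c1 c2; split=> [s phi z b sa|ind disc]; first by rewrite -fiber_box_eq //; exact: c1.
apply: c2 => [s phi z sa|]; first by rewrite fiber_box_eq //; exact: ind.
have [Da Ds] := disc; split=> // d Dd; have [s sa sP] := Ds d Dd.
exists s => // d' Dd' ag; apply: sP => // j js.
by rewrite -(GG' (Da _ Dd) (sa _ js)) -(GG' (Da _ Dd') (sa _ js)) ag.
Qed.

Lemma good_row_eq r : good_row a G r -> good_row a G' r.
Proof.
move=> rP ta s sa; apply: unboundedS (rP ta s sa) => n nP j js.
by rewrite -GG' ?nP //; exact: sa.
Qed.

End Transfer.

Hypothesis lt_wf : well_founded lt.

Lemma good_entries : exists S, forall a,
  good_column a (entries S) (S a).1 /\ good_row a (entries S) (S a).2.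
Proof.
have [|S SP] := @wf_choice W _ lt (fun=> false, fun=> false)
  (fun a f d => good_column a (entries f) d.1 /\ good_row a (entries f) d.2) lt_wf.
  move=> a f; have [c cP] := good_columnP a f; have [r rP] := good_rowP a (entries f).
  by exists (c, r).
exists S => a; have [f fS [fc fr]] := SP a.
suff E p j : below a p -> below a j -> entries f p j = entries S p j.
  by split; [exact: good_column_eq fc|exact: good_row_eq fr].
by case: p j => [y|b] [m|g] //= ba ga; rewrite ?fS.
Qed.

Hypothesis lt_irr : forall a, ~ lt a a.
Hypothesis lt_trans : forall a b c, lt a b -> lt b c -> lt a c.
Hypothesis lt_total : forall a b, [\/ lt a b, a = b | lt b a].
Hypothesis task_cofinal : forall u, ~ countable [set a | task a = u].

Lemma max_seq s : s <> [::] -> exists2 m, m \in s & forall g, g \in s -> g <> m -> lt g m.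
Proof.
elim: s => // h [|h' s] IH _; first by exists h => [|g]; rewrite inE // => /eqP.
have [//|m ms mP] := IH; have [hm|->|mh] := lt_total h m.
- exists m; first by rewrite inE ms orbT.
  by move=> g; rewrite inE => /orP[/eqP->|/mP].
- exists m => [|g]; first by rewrite inE eqxx.
  by rewrite inE => /orP[/eqP|/mP].
- exists h; first by rewrite inE eqxx.
  move=> g; rewrite inE => /orP[/eqP//|gs _].
  by have [->//|/eqP/(mP _ gs)/lt_trans] := eqVneq g m; exact.
Qed.

(** Indices not exceeding all of [C] lie in a countable union of countable initial segments, while
    [u] recurs uncountably often. *)
Lemma task_above u (C : set W) : countable C ->
  exists2 a, task a = u & forall g, C g -> lt g a.
Proof.
move=> cC; apply: contrapT => nex; apply: (task_cofinal (u := u)).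
apply: (@sub_countable _ _ _ (\bigcup_(g in C) ([set b | lt b g] `|` [set g]))).
  apply: subset_card_le => a au; apply: contrapT => na; apply: nex; exists a => // g Cg.
  have [//|ga|ag] := lt_total g a; case: na; exists g => //; first by right; rewrite ga.
  by left.
apply: bigcup_countable => // g _; exact: countableU.
Qed.

Lemma matrixP : exists F : points W -> columns W -> bool,
  [/\ bit_columns F, fiber_independent F, separates_discrete F & has_fiber_limits F].
Proof.
have [S SP] := good_entries; set F := entries S in SP.
have ind s phi z : unbounded (fiber_box F s phi z).
  (* Induction on a bound for the columns: the largest column [m] splits the box given by the
     others, which lie below [m]. *)
  have segP a s' : segment a s' -> unbounded (fiber_box F s' phi z).
    elim/(well_founded_ind lt_wf): a s' => a IH s' sa.
    have [->|/eqP/max_seq[m ms mP]] := eqVneq s' [::]; first by move=> N; exists N.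
    have sm : segment m [seq g <- s' | g != m].
      by move=> g; rewrite mem_filter => /andP[/eqP gm gs]; exact: mP.
    have := (SP m).1.1 _ phi z (phi m) sm (IH _ (sa _ ms) _ sm).
    apply: unboundedS => k [ks km] g gs; have [->//|gm] := eqVneq g m.
    by apply: ks; rewrite mem_filter gm.
  have [|a _ aP] := task_above (fun=> inl ([::], 0%N)) (C := [set g | g \in s]).
    by apply: finite_set_countable; exact: finite_seq.
  exact: (segP a).
have cols_countable (t : nat -> seq (columns W)) : countable [set g | exists n, inr g \in t n].
  apply: (@countable_inr _ _ (\bigcup_n [set` t n])) => [|g [n gt]]; last by exists n.
  by apply: bigcup_countable => // n _; exact/finite_set_countable/finite_seq.
exists F; split=> // [u x disc ux|y t].
  have /choice[s sP] := disc.
  (* Beyond [x], all [u n] and all isolating columns, so that discreteness is already visible at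
     stage [a]. *)
  have [|a au aP] := task_above (fun n => if n is n'.+1 then u n' else x)
     (C := [set g | inr g = x] `|` ([set g | exists n, inr g = u n] `|`
            [set g | exists n, inr g \in s n])).
    apply: countableU.
      by apply: (countable_inr (countable1 x)) => g <-.
    apply: countableU; last exact: cols_countable.
    apply: (@countable_inr _ _ (range u)) => [|g [n gu]]; last by exists n.
    exact: sub_countable (card_image_le _ _) _.
  have ub n : below a (u n) by case E: (u n) => [//|g]; apply: aP; right; left; exists n.
  have xb : below a x by case E: x => [//|g]; apply: aP; left.
  have ts : task_set a = range u.
    by rewrite /task_set au; apply/seteqP; split=> _ [n _ <-]; exists n.
  have Fa p : below a p -> F p (inr a) = (S a).1 p.
    by case: p => //= b ba; rewrite asboolT.
  have [] := (SP a).1.2.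
  - by move=> s' phi z _; exact: ind.
  - rewrite ts; split=> [_ [n _ <-] //|_ [n _ <-]].
    exists (s n) => [[//|g] gs|_ [n' _ <-]]; last exact: sP.
    by apply: aP; right; right; exists n.
  - by rewrite ts au => -[n _]; exact: ux.
  rewrite ts au => c0 c1; exists a; split; first by rewrite Fa.
  by move=> n; rewrite Fa //; apply: c1; exists n.
have [|a at_ aP] := task_above (fun n => inl (y n)) (C := [set g | exists n, inr g \in t n]).
  exact: cols_countable.
exists (inr a) => s.
have := (SP a).2; rewrite /good_row at_ => rowP N.
have [||n Nn nP] := rowP _ [seq j <- s | `[< below a j >]] _ N.
- by [].
- by move=> j; rewrite mem_filter => /andP[/asboolP].
exists n => //.
(* The new point copies [y n] before [a], hence on all of [t n], and the limit row from [a] on.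
   Before [a], the limit row agrees with [y n] on [s]. *)
pose phi g := if `[< lt g a >] then F (inl (y n)) (inr g) else F (inr a) (inr g).
have [k _ kP] := ind (rights (s ++ t n)) phi (y n).1 0%N.
have row_a j : j \in s -> below a j -> F (inl (y n)) j = F (inr a) j.
  move=> js ja; have := nP j; rewrite mem_filter js asboolT // => /(_ isT) ->.
  by case: j js ja => [//|g] _ ga /=; rewrite asboolF // => /lt_trans - /(_ _ ga)/lt_irr.
exists k; split=> -[m|g] jst.
- by rewrite -row_a.
- rewrite kP ?mem_rights ?mem_cat ?jst // /phi; case: asboolP => // ga; exact: row_a.
- by [].
- rewrite kP ?mem_rights ?mem_cat ?jst ?orbT // /phi asboolT //.
  by apply: aP; exists n.
Qed.
End Matrix.

(* The matrix is a phantom parameter: the topology instance below is found through it. *)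
Definition box_space (P K : Type) (F : P -> K -> bool) : Type := P.

(** * The topology given by a matrix *)

Section BoxTopology.
Context {P K : choiceType} (F : P -> K -> bool).

Definition box s x : set P := [set y | agree F s x y].

Definition box_open (U : set P) := forall x, U x -> exists s, box s x `<=` U.

Lemma box_openT : box_open setT. Proof. by move=> x _; exists [::]. Qed.

Lemma box_openI : setI_closed box_open.
Proof.
move=> U V oU oV x [/oU[s sU] /oV[t tV]]; exists (s ++ t) => y xy.
by split; [apply: sU|apply: tV] => j js; apply: xy; rewrite mem_cat js ?orbT.
Qed.

Lemma box_open_bigcup (I : Type) (f : I -> set P) :
  (forall i, box_open (f i)) -> box_open (\bigcup_i f i).
Proof.
by move=> of_ x [i _ /of_[s sf]]; exists s => y /sf fy; exists i.
Qed.

Local Notation X := (box_space F).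

HB.instance Definition _ := Choice.copy X P.
HB.instance Definition _ :=
  isOpenTopological.Build X box_openT box_openI box_open_bigcup.

Lemma open_box_space (U : set X) : open U <-> box_open U.
Proof. by []. Qed.

Lemma box_open_box s x : box_open (box s x).
Proof. by move=> y xy; exists s => w yw j js; rewrite xy // yw. Qed.

Lemma box_nbhsP (x : X) V : nbhs x V <-> exists s, box s x `<=` V.
Proof.
split=> [|[s sV]].
  by rewrite nbhsE => -[U [oU Ux] UV]; have [s sU] := oU x Ux; exists s; exact: subset_trans UV.
rewrite nbhsE; exists (box s x) => //; split=> //.
by apply/open_box_space; exact: box_open_box.
Qed.

Lemma nbhs_box s (x : X) : nbhs x (box s x).
Proof. by apply/box_nbhsP; exists s. Qed.

(** For fixed [s], agreement is an equivalence relation with the boxes as classes, so the complement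
    of a box is a union of boxes. *)
Lemma clopen_box s (x : X) : clopen (box s x : set X).
Proof.
split; first by apply/open_box_space; exact: box_open_box.
rewrite -[box s x]setCK; apply: open_closedC; apply/open_box_space => y nxy; exists s => w yw xw.
by apply: nxy => j js; rewrite xw // yw.
Qed.

Definition boxes : set (set X) := [set box s x | s in setT & x in setT].

Lemma basis_boxes : basis boxes.
Proof.
split=> [_ [s _ [x _ <-]]|x V]; first by have [] := clopen_box s x.
move=> /box_nbhsP[s sV]; exists (box s x) => //=; split=> //.
by exists s => //; exists x.
Qed.

Lemma zero_dim_box_space : zero_dim X.
Proof.
exists boxes; last exact: basis_boxes.
by move=> _ [s _ [x _ <-]]; exact: clopen_box.
Qed.

Lemma hausdorff_box_space : (forall x y, x <> y -> exists j, F x j <> F y j) ->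
  hausdorff_space X.
Proof.
move=> sep x y; apply: contraPP => /sep[j nxy] xy.
have [w [/= xw yw]] := xy _ _ (nbhs_box [:: j] x) (nbhs_box [:: j] y).
by apply: nxy; rewrite xw ?yw ?inE.
Qed.

End BoxTopology.

(** * Nonempty types of size at most the continuum *)

Section Cantor.

Definition cantor_onto (T : Type) :=
  exists e : (nat -> bool) -> T, forall t, exists w, e w = t.

Lemma cantor_onto_id : cantor_onto (nat -> bool).
Proof. by exists id => w; exists w. Qed.

Lemma cantor_onto_countType (C : countType) (c : C) : cantor_onto C.
Proof.
exists (fun w => if pselect (exists n, w n) is left h
  then odflt c (unpickle (projT1 (cid h))) else c) => t.
exists (fun n => n == pickle t); case: pselect => [h|[]]; last by exists (pickle t).
by case: cid => n /= /eqP ->; rewrite pickleK.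
Qed.

Lemma cantor_onto_sum A B : cantor_onto A -> cantor_onto B -> cantor_onto (A + B).
Proof.
move=> [e eP] [f fP].
exists (fun w => if w 0%N then inl (e (w \o S)) else inr (f (w \o S))).
case=> [a|b].
  have [w <-] := eP a; exists (fun n => if n is n'.+1 then w n' else true) => /=.
  by congr (inl (e _)); apply/funext.
have [w <-] := fP b; exists (fun n => if n is n'.+1 then w n' else false) => /=.
by congr (inr (f _)); apply/funext.
Qed.

Lemma cantor_onto_prod A B : cantor_onto A -> cantor_onto B -> cantor_onto (A * B).
Proof.
move=> [e eP] [f fP].
exists (fun w => (e (fun n => w n.*2), f (fun n => w n.*2.+1))) => -[a b].
have [w <-] := eP a; have [v <-] := fP b.
exists (fun n => if odd n then v n./2 else w n./2).
by congr (e _, f _); apply/funext => n /=; rewrite odd_double ?doubleK ?uphalf_double.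
Qed.

Lemma cantor_onto_fun A : cantor_onto A -> cantor_onto (nat -> A).
Proof.
move=> [e /choice[w wP]]; exists (fun v i => e (fun n => v (pickle (i, n)))) => u.
exists (fun m => if (unpickle m : option (nat * nat)) is Some (i, n) then w (u i) n else false).
apply/funext => i; rewrite -[RHS]wP; congr e; apply/funext => n.
by rewrite pickleK.
Qed.

(** The well-order given by CH is pulled back along a right inverse of [e] on [A]. *)
Lemma aleph1_cantor_onto (T : Type) (A : set T) (e : (nat -> bool) -> T) :
  CH -> ~ countable A -> A `<=` range e -> is_aleph1 A.
Proof.
move=> [_ [lt [irr trans total min cnt]]] ncA Ae; split=> //.
have /choice[g gP] : forall t, exists w, A t -> e w = t.
  move=> t; have [/Ae[w _ <-]|nAt] := pselect (A t); first by exists w.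
  by exists (fun=> false).
exists (fun x y => lt (g x) (g y)); split.
- by move=> x _; exact: irr.
- by move=> x y z _ _ _; exact: trans.
- move=> x y Ax Ay; have [] := total (g x) (g y) => //; [by constructor| |by constructor].
  by move=> E; constructor 2; rewrite -(gP _ Ax) E gP.
- move=> S SA [s Ss]; have [||_ [m Sm <-] mP] := min (g @` S) => //.
    by exists (g s); exists s.
  by exists m => // y Sy; apply: mP; exists y.
- move=> x Ax.
  apply: (@sub_countable _ _ _ (e @` [set w | [set: nat -> bool] w /\ lt w (g x)])).
    by apply: subset_card_le => y [Ay yx]; exists (g y); rewrite ?gP.
  by apply: sub_countable (card_image_le _ _) _; exact: cnt.
Qed.

End Cantor.

Local Notation cantor := (nat -> bool).

Lemma CH_matrix : CH -> exists F : points cantor -> columns cantor -> bool,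
  [/\ bit_columns F, fiber_independent F, separates_discrete F & has_fiber_limits F].
Proof.
move=> [unc [lt [irr trans total min cnt]]].
(* The first factor makes tasks recur: the indices of any given task map onto [cantor], so they are
   uncountable. *)
have [e eP] : cantor_onto (cantor * (nat -> points cantor)).
  apply: cantor_onto_prod; first exact: cantor_onto_id.
  apply/cantor_onto_fun/cantor_onto_sum; last exact: cantor_onto_id.
  exact: (cantor_onto_countType ([::], 0%N)).
apply: (@matrixP _ lt (fun w => (e w).2)).
- by move=> a; apply: sub_countable (cnt a I); apply: subset_card_le.
- move=> a; apply: contrapT => na.
  have [||m nm mP] := min [set b | ~ Acc lt b] => //; first by exists a.
  by apply: nm; constructor => b bm; apply: contrapT => nb; exact: (mP b nb).
- by move=> a; exact: irr.
- by move=> a b c; exact: trans.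
- by move=> a b; exact: total.
move=> u cu; apply: unc.
apply: (@sub_countable _ _ _ ((fun w => (e w).1) @` [set w | (e w).2 = u])).
  by apply: subset_card_le => w _; have [v ev] := eP (w, u); exists v; rewrite /= ev.
exact: sub_countable (card_image_le _ _) cu.
Qed.

(** * Topological properties of the space *)

Section IndependentMatrix.
Context {W : choiceType} (F : points W -> columns W -> bool).
Local Notation X := (box_space F).

Hypothesis F_bits : bit_columns F.
Hypothesis F_indep : fiber_independent F.

Lemma unbounded_fiber (s : seq (columns W)) (phi : columns W -> bool) z :
  (forall m, inl m \in s -> (m \in z) = phi (inl m)) ->
  unbounded [set k | forall j, j \in s -> F (inl (z, k)) j = phi j].
Proof.
move=> zP; apply: unboundedS (F_indep (rights s) (phi \o inr) z) => k kP [m|g] js.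
  by rewrite F_bits zP.
by apply: kP; rewrite mem_rights.
Qed.

(** Taking for [z] the bits that the pattern sets to 1 realises any finite pattern on a fibre; in
    particular the union of the fibres is dense. *)
Lemma unbounded_box (s : seq (columns W)) (phi : columns W -> bool) :
  exists z, unbounded [set k | forall j, j \in s -> F (inl (z, k)) j = phi j].
Proof.
pose ms := [seq m | j <- s, m <- if j is inl m then [:: m] else [::]].
exists [seq m <- ms | phi (inl m)]; apply: unbounded_fiber => m ms_.
rewrite mem_filter andbC; case: allpairsPdep => // -[].
by exists (inl m), m; rewrite inE.
Qed.

Lemma crowded_box_space : crowded X.
Proof.
move=> x [_ [V /box_nbhsP[s sV]]]; rewrite setIT => Vx.
have [z zP] := unbounded_box s (F x).
have [k _ kP] := zP 0%N; have [l kl lP] := zP k.+1.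
have V_eq i : (forall j, j \in s -> F (inl (z, i)) j = F x j) -> inl (z, i) = x.
  by move=> iP; have : V (inl (z, i)) by [apply: sV => j /iP]; rewrite Vx.
by have := V_eq _ lP; rewrite -(V_eq _ kP) => -[E]; rewrite E ltnn in kl.
Qed.

(** A base element around [x] contains a box on finitely many columns [s]. Any other column can be
    flipped inside that box, so the base element serves only columns in [s]. *)
Lemma not_second_countable_box_space : ~ countable [set: W] -> ~ @second_countable X.
Proof.
move=> unc [B cB [Bo Bb]]; apply: unc.
pose x : X := inl ([::], 0%N).
apply: (@sub_countable _ _ _
  (\bigcup_(b in B) [set g | b x /\ b `<=` box F [:: inr g] x])).
  apply: subset_card_le => g _; have [b [Bb_ bx] bg] := Bb x _ (nbhs_box [:: inr g] x).
  by exists b.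
apply: bigcup_countable => // b Bb_.
have [bx|nbx] := pselect (b x); last first.
  by apply: sub_countable (@countable0 W); apply: subset_card_le => g [].
have /open_box_space/(_ x bx)[s sb] := Bo _ Bb_.
apply: (@countable_inr nat W [set` s]) => [|g [_ bg]].
  exact/finite_set_countable/finite_seq.
apply: contrapT => /negP gs.
have [z zP] := unbounded_box (inr g :: s) (fun j => if j == inr g then ~~ F x j else F x j).
have [k _ kP] := zP 0%N.
have : box F s x (inl (z, k)).
  move=> j js; rewrite kP ?inE ?js ?orbT //; case: eqP => // jg.
  by rewrite -jg js in gs.
move=> /sb/bg/(_ (inr g)); rewrite inE eqxx => /(_ isT).
by rewrite kP ?inE ?eqxx //; case: (F x _).
Qed.

Definition fiber_trace (t : seq (columns W)) (y : seq nat * nat) : set X :=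
  [set p | exists2 k, p = inl (y.1, k) & agree F t p (inl y)].

Lemma countably_infinite_fiber_trace t y : countably_infinite (fiber_trace t y).
Proof.
split.
  apply: (@sub_countable _ _ _ (range (fun k => inl (y.1, k) : X))).
    by apply: subset_card_le => _ [k -> _]; exists k.
  exact: sub_countable (card_image_le _ _) _.
move=> fin; pose i k : X := inl (y.1, k).
have : finite_set (i @^-1` fiber_trace t y).
  by apply: finite_preimage => // k l _ _ [].
apply/unbounded_infinite.
apply: unboundedS (@unbounded_fiber t (F (inl y)) y.1 _).
  by move=> k kP; exists k.
by case: y {i fin} => z k m _; rewrite F_bits.
Qed.

(** Inside any box, a bit not yet constrained can be set against its constant value on the fibre,
    giving a smaller box that misses the fibre. *)
Lemma nowhere_dense_fiber_trace t y : nowhere_dense (fiber_trace t y).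
Proof.
apply/seteqP; split=> // x; rewrite /interior /= => /box_nbhsP[s sA].
(* Exceeds every bit column in [s]. *)
pose m := (\sum_(j <- s) if j is inl i then i.+1 else 0%N)%N.
have ms : inl m \notin s.
  apply/negP => ms; suff : (m < m)%N by rewrite ltnn.
  rewrite {2}/m (big_rem _ ms) /=; exact: leq_addr.
pose phi j := if j == inl m then m \notin y.1 else F x j.
have [z zP] := unbounded_box (inl m :: s) phi.
have [k _ kP] := zP 0%N.
have : box F s x (inl (z, k)).
  move=> j js; rewrite kP ?inE ?js ?orbT // /phi; case: eqP => // jm.
  by rewrite -jm js in ms.
move=> /sA/(_ _ (nbhs_box [:: inl m] _))[_ [[l -> _]]] /(_ (inl m)).
rewrite inE eqxx => /(_ isT); rewrite kP ?inE ?eqxx // /phi eqxx F_bits.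
by case: (m \in y.1).
Qed.

Hypothesis F_limit : has_fiber_limits F.

Lemma selectively_pseudocompact_box_space : selectively_pseudocompact (@Nwd_omega X).
Proof.
move=> U oU U0 _.
have /choice[ty tyP] : forall n, exists ty : seq (columns W) * (seq nat * nat),
    box F ty.1 (inl ty.2) `<=` U n.
  move=> n; have [x Ux] := U0 n.
  have /open_box_space/(_ x Ux)[s sU] := oU n.
  (* By density, the box inside [U n] can be centred at a point of a fibre. *)
  have [z /(_ 0%N)[k _ kP]] := unbounded_box s (F x).
  by exists (s, (z, k)) => w wP; apply: sU => j js; rewrite -wP // kP.
pose t n := (ty n).1; pose y n := (ty n).2.
exists (fun n => fiber_trace (t n) (y n)); split=> [n|].
  split; first by split; [exact: countably_infinite_fiber_trace|exact: nowhere_dense_fiber_trace].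
  by move=> _ [k -> kP]; apply: tyP => j /kP.
have [x xP] := F_limit y t; exists x => V /box_nbhsP[s sV].
apply: unbounded_infinite; apply: unboundedS (xP s) => n [k [kx ky]].
exists (inl ((y n).1, k)); split; last by exists k.
by apply: sV => j /kx.
Qed.

Hypothesis F_separates : separates_discrete F.

(** A constant sequence is discrete, so the separation property applies to two distinct points. *)
Lemma hausdorff_separating : hausdorff_space X.
Proof.
apply: hausdorff_box_space => x y xy.
have [||g [Fx Fy]] := @F_separates (fun=> x) y => //; first by exists [::].
by exists (inr g); rewrite Fx (Fy 0%N).
Qed.

Lemma countable_discrete_closed (D : set X) : countable D -> discrete_subset D -> closed D.
Proof.
move=> /countable_injP[f finj] disc.
have [->|/set0P[d0 Dd0]] := eqVneq D set0; first exact: closed0.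
have /choice[u uP] : forall n, exists d, D d /\ forall d', D d' -> f d' = n -> d' = d.
  move=> n; have [[d [Dd fd]]|nd] := pselect (exists d, D d /\ f d = n).
    by exists d; split=> // d' Dd' fd'; apply: finj; rewrite ?inE // fd.
  by exists d0; split=> // d' Dd' fd'; case: nd; exists d'.
rewrite -[D]setCK; apply: open_closedC; apply/open_box_space => x Dx.
have [n|n|g [Fx Fu]] := @F_separates u x.
- have [Du _] := uP n; have [_ [V /box_nbhsP[s sV] VD]] := disc _ Du.
  exists s => n' ag; suff : (V `&` D) (u n') by rewrite VD.
  by split; [exact: sV|have [] := uP n'].
- by move=> ux; apply: Dx; rewrite -ux; have [] := uP n.
exists [:: inr g] => d dP Dd; have := dP (inr g); rewrite inE eqxx => /(_ isT).
by have [_ /(_ _ Dd erefl) ->] := uP (f d); rewrite Fx Fu.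
Qed.

End IndependentMatrix.

(** * Size and weight of the space, and the conclusion *)

Lemma cantor_onto_columns : cantor_onto (columns cantor).
Proof.
by apply: cantor_onto_sum (cantor_onto_id); exact: (cantor_onto_countType 0%N).
Qed.

Lemma cantor_onto_points : cantor_onto (points cantor).
Proof.
by apply: cantor_onto_sum (cantor_onto_id); exact: (cantor_onto_countType ([::], 0%N)).
Qed.

Lemma boxes_range (F : points cantor -> columns cantor -> bool) :
  exists e : cantor -> set (box_space F), @boxes _ _ F `<=` range e.
Proof.
have [e eP] : cantor_onto ((nat * (nat -> columns cantor)) * points cantor).
  apply: cantor_onto_prod cantor_onto_points; apply: cantor_onto_prod.
    exact: (cantor_onto_countType 0%N).
  exact: cantor_onto_fun cantor_onto_columns.
(* A finite list of columns is coded by its length and an infinite sequence extending it. *)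
exists (fun w => let: (n, f, x) := e w in box F (mkseq f n) x) => _ [s _ [x _ <-]].
have [w ew] := eP (size s, nth (inl 0%N) s, x).
by exists w => //; rewrite ew mkseq_nth.
Qed.

Theorem theorem3p1 :
  CH ->
  exists X : topologicalType,
    [/\ crowded X /\ zero_dim X, hausdorff_space X,
        is_aleph1 [set: X] /\ weight_aleph1 X,
        (forall D : set X, countably_infinite D -> discrete_subset D -> closed D)
      & selectively_pseudocompact (@Nwd_omega X)].
Proof.
move=> ch; have [F [F_bits F_indep F_separates F_limit]] := CH_matrix ch.
have [unc _] := ch.
have nsc := not_second_countable_box_space F_bits F_indep unc.
exists (box_space F : topologicalType); split.
- by split; [exact: crowded_box_space|exact: zero_dim_box_space].
- exact: hausdorff_separating.
- split.
    have [e eP] := cantor_onto_points.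
    apply: (@aleph1_cantor_onto _ _ e) => //.
      by move=> cX; apply: unc; apply: (countable_inr cX).
    by move=> x _; have [w <-] := eP x; exists w.
  split=> //; exists (@boxes _ _ F); first exact: basis_boxes.
  have [e eP] := boxes_range F.
  apply: (aleph1_cantor_onto ch _ eP) => cB.
  by apply: nsc; exists (@boxes _ _ F) => //; exact: basis_boxes.
- by move=> D [cD _]; exact: countable_discrete_closed.
- exact: selectively_pseudocompact_box_space.
Qed.
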